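(* Let $\mathbb{F}$ be a field of characteristic $0$, let $\mathcal{D}_\infty=\langle z,s : s^2=1,\ s^{-1}zs=z^{-1}\rangle$ be the infinite dihedral group, and let $$\mathcal{A}=\mathrm{Span}_{\mathbb{F}}\{\underline{C} : C\in\mathcal{D}\},$$ where $$\mathcal{D}=\{\{z^{i},z^{-i},z^{i}s,z^{-i}s\} : i\in\mathbb{Z},\ 2\nmid i\}\cup\{\{z^{i}s^{j},z^{-i}s^{j}\} : i\in\mathbb{Z},\ 2\mid i,\ j\in\{0,1\}\}.$$ Then $\mathcal{A}$ is a Schur ring over $\mathcal{D}_\infty$ such that $\langle z\rangle$ is not an $\mathcal{A}$-subgroup, and furthermore $\mathcal{A}$ is not traditional.
   Context: Let $G$ be a group and $\mathbb{F}$ a field of characteristic $0$. For a finite non-empty subset $C\subseteq G$ put $\underline{C}=\sum_{g\in C}g\in\mathbb{F}[G]$ and $C^*=\{g^{-1}: g\in C\}$. Schur ring: let $\mathcal{D}$ be a partition of $G$ all of whose parts are finite, and let $\mathcal{A}$ be the $\mathbb{F}$-subspace of $\mathbb{F}[G]$ spanned by $\{\underline{C}: C\in\mathcal{D}\}$. Then $\mathcal{A}$ is a Schur ring over $G$ if (1) $\{1\}\in\mathcal{D}$; (2) $C^*\in\mathcal{D}$ for every $C\in\mathcal{D}$; (3) for all $C,D\in\mathcal{D}$, $\underline{C}\cdot\underline{D}=\sum_{E\in\mathcal{D}}\lambda_{CDE}\underline{E}$, where all but finitely many $\lambda_{CDE}$ are $0$. The elements of $\mathcal{D}=\mathcal{D}(\mathcal{A})$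 are called the basic sets of $\mathcal{A}$. An $\mathcal{A}$-set is a union of basic sets of $\mathcal{A}$; an $\mathcal{A}$-subgroup is a subgroup of $G$ that is an $\mathcal{A}$-set. Traditional: a Schur ring $\mathcal{A}$ over $G$ is called traditional if it is of at least one of the following types. - Trivial Schur ring (only when $G$ is finite): the basic sets are $\{1\}$ and $G\setminus\{1\}$. - Orbit Schur ring: $\mathcal{A}=\mathbb{F}[G]^{\mathcal{K}}$, the set of elements of $\mathbb{F}[G]$ fixed by $\mathcal{K}$ (acting linearly), for some finite subgroup $\mathcal{K}\le\mathrm{Aut}(G)$; its basic sets are the $\mathcal{K}$-orbits on $G$. (The case $\mathcal{K}=1$ gives $\mathbb{F}[G]$.) - Tensor product of Schur rings over smaller subgroups: $G=H\times K$ is an internal direct product of proper subgroups $H,K$, and there are Schur rings $\mathcal{A}_H$ over $H$ and $\mathcal{A}_K$ over $K$ such that the basic sets of $\mathcal{A}$ are exactly the sets $CD$ with $C\in\mathcal{D}(\mathcal{A}_H)$, $D\in\mathcal{D}(\mathcal{A}_K)$. - Wedge product: there exist nontrivial proper $\mathcal{A}$-subgroups $H,K$ of $G$ such that $K\le H$, $K\unlhd G$, and every basic set of $\mathcal{A}$ not contained in $H$ is a union of $K$-cosets. *)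

(* Defs.v *)
From HB Require Import structures.
From mathcomp Require Import all_boot all_order all_algebra finmap.
From mathcomp.classical Require Import boolp classical_sets functions.
From mathcomp.classical Require Import cardinality fsbigop.
From mathcomp.multinomials Require Import monalg.

Set Implicit Arguments.
Unset Strict Implicit.
Unset Printing Implicit Defensive.

Import GRing.Theory.

Local Open Scope classical_set_scope.
Local Open Scope ring_scope.

Section Groups.
Variable G : groupType.
Implicit Types (x y : G) (X Y H K : set G).

Definition expgz x (i : int) : G :=
  match i with Posz n => (x ^+ n)%g | Negz n => (x ^- n.+1)%g end.

Definition set_mulg X Y : set G := [set (x * y)%g | x in X & y in Y].

Definition set_invg X : set G := [set x^-1%g | x in X].

Definition subgroup H : Prop := group_closed [in H].

Definition generated X : set G := smallest subgroup X.

Definition normal_subgroup K : Prop :=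
  subgroup K /\ forall x y, K x -> K (x ^ y)%g.

Definition internal_direct_product H K : Prop :=
  [/\ forall x y, H x -> K y -> commute x y,
      H `&` K = [set 1%g] & set_mulg H K = setT].

(* Closure under inverses is part of the last clause: an automorphism in K is
   a multiplicative map with a two-sided inverse in K. *)
Definition finite_automorphism_group (K : set (G -> G)) : Prop :=
  [/\ finite_set K,
      forall k, K k -> {morph k : x y / (x * y)%g},
      K id,
      forall k l, K k -> K l -> K (k \o l) &
      forall k, K k -> exists l, [/\ K l, cancel k l & cancel l k]].

End Groups.

(* The group algebra F[G] is carried by the F-vector space {malg F[G]} of
   finitely supported functions G -> F; the product that [monalg] puts on it
   is only available when the only unit of G is 1. *)
Section GroupAlgebra.
Variables (F : fieldType) (G : groupType).
Implicit Types (a b : {malg F[G]}) (C : set G) (D : set (set G)).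

Definition galg_mul a b : {malg F[G]} :=
  \sum_(g <- msupp a) \sum_(h <- msupp b) << a@_g * b@_h *g (g * h)%g >>.

Definition galg_act (k : G -> G) a : {malg F[G]} :=
  \sum_(g <- msupp a) << a@_g *g k g >>.

Definition galg_fixed (K : set (G -> G)) : set {malg F[G]} :=
  [set a | forall k, K k -> galg_act k a = a].

Definition set_sum C : {malg F[G]} := \sum_(g \in C) << (1 : F) *g g >>.

(* Both [set_sum] and the sum below are sums of finite support, which return 0
   on infinite support; this is why the finiteness condition is needed here,
   and the finiteness of the parts in [schur_ring]. *)
Definition schur_span D : set {malg F[G]} :=
  [set a | exists2 lambda : set G -> F,
     finite_set (D `&` [set E | lambda E != 0]) &
     a = \sum_(E \in D) lambda E *: set_sum E].

End GroupAlgebra.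

Arguments galg_fixed F {G} K.
Arguments set_sum F {G} C.
Arguments schur_span F {G} D.

Section SchurRings.
Variables (F : fieldType) (G : groupType).
Implicit Types (H K S : set G) (D : set (set G)) (A : set {malg F[G]}).

(* A is a Schur ring over the subgroup H of G whose set of basic sets is D.
   The Schur rings over H are taken inside F[H], seen as a subalgebra of F[G];
   those over G itself are obtained for H = setT. *)
Definition schur_ring H D A : Prop :=
  [/\ subgroup H,
      partition D id H /\ (forall C, D C -> finite_set C),
      A = schur_span F D &
      [/\ D [set 1%g],
          forall C, D C -> D (set_invg C) &
          forall C C', D C -> D C' ->
            schur_span F D (galg_mul (set_sum F C) (set_sum F C'))]].

Definition schur_set D S : Prop :=
  exists2 B : set (set G), B `<=` D & S = \bigcup_(C in B) C.

Definition schur_subgroup D H : Prop := subgroup H /\ schur_set D H.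

Definition trivial_schur_ring D : Prop :=
  finite_set [set: G] /\ D = [set [set 1%g]; ~` [set 1%g]].

Definition orbit_schur_ring A : Prop :=
  exists2 K : set (G -> G), finite_automorphism_group K & A = galg_fixed F K.

Definition tensor_schur_ring D : Prop :=
  exists H K : set G,
    [/\ subgroup H /\ H != setT, subgroup K /\ K != setT,
        internal_direct_product H K &
        exists DH DK : set (set G),
          [/\ schur_ring H DH (schur_span F DH),
              schur_ring K DK (schur_span F DK) &
              D = [set set_mulg C C' | C in DH & C' in DK]]].

Definition wedge_schur_ring D : Prop :=
  exists H K : set G,
    [/\ [/\ schur_subgroup D H, H != [set 1%g] & H != setT],
        [/\ schur_subgroup D K, K != [set 1%g] & K != setT],
        K `<=` H, normal_subgroup K &
        forall C, D C -> ~ C `<=` H ->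
          exists X : set G, C = \bigcup_(x in X) set_mulg [set x] K].

Definition traditional D A : Prop :=
  [\/ trivial_schur_ring D, orbit_schur_ring A,
      tensor_schur_ring D | wedge_schur_ring D].

End SchurRings.

Definition dihedral_relations (G : groupType) (z s : G) : Prop :=
  (s ^+ 2 = 1)%g /\ (s^-1 * z * s = z^-1)%g.

(* G = < z, s | s ^ 2 = 1, s ^ -1 z s = z ^ -1 >: the elements z and s generate
   G, satisfy the relations, and can be mapped to any two elements of any group
   that satisfy them. *)
Definition infinite_dihedral (G : groupType) (z s : G) : Prop :=
  [/\ dihedral_relations z s, generated [set z; s] = setT &
      forall (G' : groupType) (z' s' : G'), dihedral_relations z' s' ->
        exists f : {multiplicative G -> G'}, f z = z' /\ f s = s'].

(* The presentation is realized by Z x| (Z/2), where (i, b) stands for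
   z ^ i * s ^ b. *)
Definition dihedral_model : Type := (int * bool)%type.
HB.instance Definition _ := Choice.on dihedral_model.

Section DihedralModel.
Implicit Types x y : dihedral_model.

Let one : dihedral_model := (0, false).
Let mul x y : dihedral_model :=
  (if x.2 then x.1 - y.1 else x.1 + y.1, x.2 (+) y.2).
Let inv x : dihedral_model := (if x.2 then x.1 else - x.1, x.2).

Fact dihedral_mulgA : associative mul.
Proof.
move=> [i b] [j c] [k d]; rewrite /mul /= addbA; congr pair.
by case: b c => [] [] /=; rewrite ?opprD ?opprK ?addrA.
Qed.
Fact dihedral_mul1g : left_id one mul.
Proof. by move=> [i b]; rewrite /mul /= add0r. Qed.
Fact dihedral_mulg1 : right_id one mul.
Proof. by move=> [i []]; rewrite /mul /= ?subr0 ?addr0. Qed.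
Fact dihedral_mulVg : left_inverse one inv mul.
Proof. by move=> [i []]; rewrite /mul /= ?subrr ?addNr. Qed.
Fact dihedral_mulgV : right_inverse one inv mul.
Proof. by move=> [i []]; rewrite /mul /= ?subrr. Qed.

HB.instance Definition _ := isGroup.Build dihedral_model
  dihedral_mulgA dihedral_mul1g dihedral_mulg1 dihedral_mulVg dihedral_mulgV.

Lemma dihedral_mulE x y :
  (x * y)%g = (if x.2 then x.1 - y.1 else x.1 + y.1, x.2 (+) y.2).
Proof. by []. Qed.

End DihedralModel.

Section ExpgzTheory.
Variable G : groupType.
Implicit Types x y z s : G.

Lemma expgzS x i : expgz x (i + 1) = (expgz x i * x)%g.
Proof.
case: i => [n|[|n]]; rewrite /expgz.
- by rewrite -PoszD addn1 /= expgSr.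
- by rewrite /= expg1 mulVg.
- have -> : Negz n.+1 + 1 = Negz n.
    by rewrite !NegzE -[n.+2]addn1 PoszD opprD subrK.
  by rewrite [in RHS]expgS invgM mulgVK.
Qed.

Lemma expgzP x i : expgz x (i - 1) = (expgz x i / x)%g.
Proof. by rewrite -[i in RHS](subrK 1) expgzS mulgK. Qed.

Lemma expgzD x i j : expgz x (i + j) = (expgz x i * expgz x j)%g.
Proof.
elim: j => [|n IHn|n IHn]; first by rewrite addr0 mulg1.
- by rewrite -addn1 PoszD addrA !expgzS IHn mulgA.
- by rewrite -addn1 PoszD opprD addrA !expgzP IHn mulgA.
Qed.

Lemma expgzN x i : expgz x (- i) = (expgz x i)^-1%g.
Proof. by apply/esym/mulg1_eq; rewrite -expgzD subrr. Qed.

Lemma dihedral_expgzJ z s i : dihedral_relations z s ->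
  (s * expgz z i = expgz z (- i) * s)%g.
Proof.
move=> [s2 zs]; have sV : (s^-1 = s)%g by apply: mulg1_eq; rewrite -expg2.
have sz : (s * z = z^-1 * s)%g by rewrite -zs sV -!mulgA -expg2 s2 mulg1.
have szV : (s * z^-1 = z * s)%g.
  by apply: (mulIg z); rewrite mulgVK -mulgA sz mulgA mulgV mul1g.
elim: i => [|n IHn|n IHn]; first by rewrite oppr0 mulg1 mul1g.
- rewrite -addn1 PoszD expgzS opprD expgzP mulgA IHn -!mulgA sz //.
- rewrite -addn1 PoszD opprD expgzP mulgA IHn -mulgA szV !opprD !opprK.
  by rewrite expgzS mulgA.
Qed.

End ExpgzTheory.

Definition model_z : dihedral_model := (1, false).
Definition model_s : dihedral_model := (0, true).

Lemma model_expgz i : expgz model_z i = (i, false).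
Proof.
elim: i => [//|n IHn|n IHn].
- by rewrite -addn1 PoszD expgzS IHn.
- by rewrite -addn1 PoszD opprD expgzP IHn.
Qed.

Lemma model_infinite_dihedral : infinite_dihedral model_z model_s.
Proof.
split=> [//||G' z' s' rel].
  apply/seteqP; split=> // -[i b] _ H [sgH zsH].
  have zH : model_z \in [in H] by rewrite unfold_in; apply/mem_set/zsH; left.
  have sH : model_s \in [in H] by rewrite unfold_in; apply/mem_set/zsH; right.
  have ziH : expgz model_z i \in [in H].
    elim: i => [|n IHn|n IHn]; first exact: sgH.1.
    - by rewrite -addn1 PoszD expgzS (group_closedM sgH).
    - by rewrite -addn1 PoszD opprD expgzP; apply: sgH.2.
  suff : ((i, b) : dihedral_model) \in [in H].
    by rewrite unfold_in => /set_mem.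
  have -> : (i, b) = (expgz model_z i * (if b then model_s else 1))%g.
    by rewrite model_expgz; case: b; rewrite dihedral_mulE /= addr0.
  by apply: (group_closedM sgH) => //; case: b => //; exact: sgH.1.
pose f (x : dihedral_model) : G' :=
  (expgz z' x.1 * (if x.2 then s' else 1))%g.
have fM : {morph f : x y / (x * y)%g}.
  have s2 : (s' * s' = 1)%g by rewrite -expg2 rel.1.
  move=> [i []] [j c]; rewrite /f /=; last by rewrite expgzD mulg1 mulgA.
  rewrite expgzD -!mulgA; congr (_ * _)%g.
  rewrite mulgA (dihedral_expgzJ _ rel) -mulgA; congr (_ * _)%g.
  by case: c => /=; rewrite ?mulg1 ?s2.
pose fm := monoid.isMultiplicative.Build _ _ f fM.
exists (HB.pack f fm : {multiplicative dihedral_model -> G'}).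
by rewrite /= /f /= mulg1 mul1g.
Qed.

Section Partition.
Variables (G : groupType) (z s : G).
Local Notation "x ^z i" := (expgz x i) (at level 29).
Local Open Scope group_scope.

Definition dihedral_partition : set (set G) :=
  [set [set z ^z i; z ^z (- i)%R; z ^z i * s; z ^z (- i)%R * s]
     | i in [set i : int | ~~ (2 %| i)%Z]]
  `|` [set [set z ^z i * s ^+ j; z ^z (- i)%R * s ^+ j]
     | i in [set i : int | (2 %| i)%Z] & j in `I_2].

End Partition.

(* Main.v *)
Require Import Defs.
From mathcomp Require Import all_boot all_algebra finmap.
From mathcomp Require Import zify.
From mathcomp.classical Require Import boolp classical_sets.
From mathcomp.classical Require Import cardinality fsbigop.
From mathcomp.multinomials Require Import monalg.

Local Open Scope classical_set_scope.

(* Write c_i = z^i + z^-i. Then s commutes with c_i and c_i c_j = c_(i+j) + c_(i-j),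
   so the span of the c_i and c_i s for i even and of the c_i (1 + s) for i odd is
   closed under products: the product of two elements of the last kind has even
   indices. Neither the tensor nor the wedge decomposition can occur, because every
   nontrivial normal subgroup contains some z^i with i <> 0: two such subgroups
   always meet, and none of them is finite. *)

(** * The product of the group algebra and spans of set sums *)

Section GroupAlgebra.
Set Implicit Arguments.
Unset Strict Implicit.
Import GRing.Theory.
Local Open Scope fset_scope.
Local Open Scope classical_set_scope.
Local Open Scope ring_scope.
Context {F : fieldType} {G : groupType}.
Implicit Types (a b : {malg F[G]}) (C E : set G) (D : set (set G)) (g h : G).

(** Coefficients vanish outside the supports, so both sums may run over larger finite sets. The
    exact supports change under addition and scaling; with common index sets, bilinearity is checked
    term by term. *)
Lemma galg_mulEw (d d' : {fset G}) a b :
    (msupp a `<=` d)%fset -> (msupp b `<=` d')%fset ->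
  galg_mul a b =
    \sum_(g <- d) \sum_(h <- d') << a@_g * b@_h *g (g * h)%g >> :> {malg F[G]}.
Proof.
move=> sd sd'; rewrite /galg_mul (big_fset_incl _ sd) => [|g _ /mcoeff_outdom a0].
  apply: eq_bigr => g _; apply: big_fset_incl sd' _ => h _ /mcoeff_outdom ->.
  by rewrite mulr0 monalgU0.
by rewrite big1// => h _; rewrite a0 mul0r monalgU0.
Qed.

Lemma galg_mulDl b : {morph (@galg_mul F G)^~ b : a a' / a + a'}.
Proof.
move=> a a'; have b_b := fsubset_refl (msupp b).
rewrite (galg_mulEw (@msuppD_le _ _ a a') b_b).
rewrite (galg_mulEw (fsubsetUl (msupp a) (msupp a')) b_b).
rewrite (galg_mulEw (fsubsetUr (msupp a) (msupp a')) b_b).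
rewrite -big_split; apply: eq_bigr => g _; rewrite -big_split.
by apply: eq_bigr => h _; rewrite mcoeffD mulrDl monalgUD.
Qed.

Lemma galg_mulDr a : {morph @galg_mul F G a : b b' / b + b'}.
Proof.
move=> b b'; have a_a := fsubset_refl (msupp a).
rewrite (galg_mulEw a_a (@msuppD_le _ _ b b')).
rewrite (galg_mulEw a_a (fsubsetUl (msupp b) (msupp b'))).
rewrite (galg_mulEw a_a (fsubsetUr (msupp b) (msupp b'))).
rewrite -big_split; apply: eq_bigr => g _; rewrite -big_split.
by apply: eq_bigr => h _; rewrite mcoeffD mulrDr monalgUD.
Qed.

Lemma scale_mkmalgU (c e : F) g : c *: << e *g g >> = << c * e *g g >> :> {malg F[G]}.
Proof. by apply/malgP => h; rewrite mcoeffZ !mcoeffU mulrnAr. Qed.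

Lemma galg_mulZ (c c' : F) a b :
  galg_mul (c *: a) (c' *: b) = (c * c') *: galg_mul a b.
Proof.
rewrite (galg_mulEw (@msuppZ_le _ _ c a) (@msuppZ_le _ _ c' b)) scaler_sumr.
apply: eq_bigr => g _; rewrite scaler_sumr; apply: eq_bigr => h _.
by rewrite !mcoeffZ scale_mkmalgU mulrACA.
Qed.

Lemma galg_mulUU g h :
  galg_mul << g >> << h >> = << (g * h)%g >> :> {malg F[G]}.
Proof.
rewrite (@galg_mulEw [fset g] [fset h]) ?msuppU_le//.
by rewrite !big_seq_fset1 !mcoeffUU mulr1.
Qed.

(** Injectivity of [k] makes [g] the only preimage of [k g], so no other coefficient of [a]
    contributes. *)
Lemma mcoeff_galg_act (k : G -> G) a g : injective k ->
  (galg_act k a)@_(k g) = a@_g.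
Proof.
move=> k_inj; rewrite [in RHS](monalgE a) /galg_act !raddf_sum /=.
by apply: eq_bigr => h _; rewrite !mcoeffU inj_eq.
Qed.

Lemma set_sum_seq (r : seq G) : uniq r ->
  set_sum F [set` r] = \sum_(g <- r) << g >>.
Proof. by move=> r_uniq; rewrite /set_sum -fsbig_seq. Qed.

Lemma mcoeff_set_sum C g : finite_set C -> (set_sum F C)@_g = (g \in C)%:R.
Proof.
move=> /finite_seqP[r0 ->]; set C' := [set` _].
(* Repetitions are removed first: a repeated element would be counted twice in a sum over the
   list. *)
have [r r_uniq ->] : exists2 r, uniq r & C' = [set` r].
  exists (undup r0); first exact: undup_uniq.
  by apply/seteqP; split=> h /=; rewrite mem_undup.
rewrite set_sum_seq// raddf_sum /= mem_setE.
have [gr|gr] := boolP (g \in r).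
  rewrite (bigD1_seq g)//= mcoeffUU big1 ?addr0// => h /negPf hg.
  by rewrite mcoeffU hg.
rewrite big_seq big1// => h hr; rewrite mcoeffU.
by case: eqP => // hg; rewrite -hg hr in gr.
Qed.

(** The parts left out of [r] have coefficient 0. The freedom in choosing [r] lets combinations with
    different supports be written over one list. *)
Lemma schur_spanE D (r : seq (set G)) (lambda : set G -> F) : uniq r ->
    [set` r] `<=` D -> D `&` [set E | lambda E != 0] `<=` [set` r] ->
  \sum_(E \in D) lambda E *: set_sum F E =
    \sum_(E <- r) lambda E *: set_sum F E.
Proof.
move=> r_uniq rD Dr; rewrite (fsbigE r) // => [|E DE Er].
  rewrite big_seq_cond [RHS]big_seq; apply: eq_bigl => E.
  by rewrite andb_idr// => /rD /mem_set.
have [->|l0] := eqVneq (lambda E) 0; first by rewrite scale0r.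
by have /Dr : (D `&` [set E | lambda E != 0]) E by []; rewrite /= (negPf Er).
Qed.

Lemma schur_spanZ D (c : F) a : schur_span F D a -> schur_span F D (c *: a).
Proof.
move=> [l l_fin ->]; have [->|c0] := eqVneq c 0.
  exists (fun=> 0); last by rewrite scale0r fsbig1// => E _; rewrite scale0r.
  by apply: sub_finite_set l_fin => E [] /=; rewrite eqxx.
exists (fun E => c * l E).
  by apply: sub_finite_set l_fin => E []; rewrite /= mulf_eq0 (negPf c0).
have [r_mem r_uniq] : [set` fset_set (D `&` [set E | l E != 0])] =
    D `&` [set E | l E != 0] /\ uniq (fset_set (D `&` [set E | l E != 0])).
  by rewrite fset_setK ?fset_uniq.
rewrite !(@schur_spanE D (fset_set (D `&` [set E | l E != 0])))//.
- by rewrite scaler_sumr; apply: eq_bigr => E _; rewrite scalerA.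
- by rewrite r_mem => E [].
- by rewrite r_mem => E [DE]; rewrite /= mulf_eq0 (negPf c0).
- by rewrite r_mem => E [].
- by rewrite r_mem.
Qed.

Lemma schur_spanD D a b :
  schur_span F D a -> schur_span F D b -> schur_span F D (a + b).
Proof.
move=> [l l_fin ->] [m m_fin ->].
set L := _ `&` _ in l_fin; set M := _ `&` _ in m_fin.
have LM_fin : finite_set (L `|` M) by rewrite finite_setU.
(* Only an inclusion, since the two coefficients may cancel. *)
have lm_sub : D `&` [set E | l E + m E != 0] `<=` L `|` M.
  move=> E [DE /= lm0]; have [lE|lE] := eqVneq (l E) 0; last by left.
  by right; split=> //=; rewrite lE add0r in lm0.
exists (fun E => l E + m E); first exact: sub_finite_set lm_sub LM_fin.
have [r_mem r_uniq] : [set` fset_set (L `|` M)] = L `|` M /\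
    uniq (fset_set (L `|` M)).
  by rewrite fset_setK ?fset_uniq.
have LMD : L `|` M `<=` D by move=> E [] [].
rewrite !(@schur_spanE D (fset_set (L `|` M))) ?r_mem//.
by rewrite -big_split; apply: eq_bigr => E _; rewrite scalerDl.
Qed.

Lemma schur_span_set_sum D C : D C -> schur_span F D (set_sum F C).
Proof.
move=> DC; pose l E : F := (E == C)%:R.
have l_sub : D `&` [set E | l E != 0] `<=` [set C].
  by move=> E [_]; rewrite /= /l; case: (eqVneq E C) => [->//|_]; rewrite mulr0n eqxx.
exists l; first exact: sub_finite_set l_sub (finite_set1 C).
rewrite (@schur_spanE D [:: C])//; last 2 first.
- by move=> E; rewrite /= inE => /eqP ->.
- by move=> E /l_sub ->; rewrite /= inE.
by rewrite big_seq1 /l eqxx scale1r.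
Qed.

(** The parts are disjoint, so [C] is the only one that contains [g] or [h], and each set sum has
    equal coefficients at both. This serves to show that an element lies outside the span. *)
Lemma mcoeff_schur_span D a C g h : trivIset D id ->
    (forall E, D E -> finite_set E) -> schur_span F D a ->
  D C -> C g -> C h -> a@_g = a@_h.
Proof.
move=> D_triv D_fin [l _ ->] DC Cg Ch; rewrite !raddf_sum /=.
apply: eq_big_seq => E; case: finite_supportP => // X XD _ _ /XD DE.
have E_fin := D_fin E DE; rewrite !mcoeffZ !mcoeff_set_sum//; congr (_ * _%:R).
have CE x : C x -> (x \in E) = (E == C) :> bool.
  move=> Cx; apply/idP/eqP => [/set_mem Ex|->]; last exact/mem_set.
  by apply: D_triv => //; exists x.
by rewrite !CE.
Qed.

End GroupAlgebra.

(** * Subgroups and internal direct products *)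

Section Subgroups.
Context {G : groupType}.
Implicit Types (H K N : set G) (x y : G).

Lemma subgroup1 H : subgroup H -> H 1%g.
Proof. by move=> sgH; apply: set_mem; exact: sgH.1. Qed.

Lemma subgroupM H x y : subgroup H -> H x -> H y -> H (x * y)%g.
Proof. by move=> sgH /mem_set Hx /mem_set Hy; apply/set_mem/(group_closedM sgH). Qed.

Lemma subgroupV H x : subgroup H -> H x -> H x^-1%g.
Proof. by move=> sgH /mem_set Hx; apply/set_mem/(group_closedV sgH). Qed.

Lemma subgroup_expgz H x (i : int) : subgroup H -> H x -> H (expgz x i).
Proof.
move=> sgH Hx; have Hxn n : H (x ^+ n)%g.
  elim: n => [|n IHn]; first exact: subgroup1.
  by rewrite expgS; apply: subgroupM.
by case: i => n; rewrite /expgz //; apply: subgroupV.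
Qed.

Lemma internal_direct_product_sym H K : subgroup H -> subgroup K ->
  internal_direct_product H K -> internal_direct_product K H.
Proof.
move=> sgH sgK [cHK HK1 HKT]; split; first by move=> x y Kx Hy; exact/esym/cHK.
  by rewrite setIC.
apply/seteqP; split=> // x _; have : (set_mulg H K) x by rewrite HKT.
move=> [h Hh [k Kk hk]]; exists k => //; exists h => //; rewrite -hk; exact/esym/cHK.
Qed.

(** Write [y = h * k]: conjugation by [h] preserves [H], and conjugation by [k] is trivial on [H]
    because the factors commute. *)
Lemma internal_direct_product_normal H K : subgroup H ->
  internal_direct_product H K -> normal_subgroup H.
Proof.
move=> sgH [cHK _ HKT]; split=> // x y Hx.
have : (set_mulg H K) y by rewrite HKT.
move=> [h Hh [k Kk <-]]; have Hxh : H (x ^ h)%g.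
  by rewrite conjgE; do !apply: subgroupM => //; apply: subgroupV.
by rewrite conjgM [X in H X]conjgE (cHK _ _ Hxh Kk) mulKg.
Qed.

(** If [H] were trivial, the product of [H] and [K] would be [K], which is proper. *)
Lemma internal_direct_product_neq1 H K : subgroup K -> K != setT ->
  internal_direct_product H K -> exists2 x, H x & x != 1%g.
Proof.
move=> sgK /eqP K_neqT [_ _ HKT]; apply: contrapT => H1; apply: K_neqT.
apply/seteqP; split=> // x _; have : (set_mulg H K) x by rewrite HKT.
move=> [h Hh [k Kk <-]]; have [->|h1] := eqVneq h 1%g; first by rewrite mul1g.
by case: H1; exists h.
Qed.

End Subgroups.

(** The partition gives its parts as explicit sets, while set sums are computed over lists; this
    lemma and the next pass between the two. *)
Lemma set_seq2 (T : eqType) (x y : T) : [set` [:: x; y]] = [set x; y].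
Proof.
apply/seteqP; split=> t /=; rewrite !inE; first by case/orP => /eqP; [left|right].
by case=> ->; rewrite eqxx ?orbT.
Qed.

Lemma set_seq4 (T : eqType) (x y u v : T) :
  [set` [:: x; y; u; v]] = [set x; y; u; v].
Proof.
apply/seteqP; split=> t /=; rewrite !inE; last first.
  by case=> [[[]|]|] ->; rewrite eqxx ?orbT.
by case/or4P=> /eqP ->; [do 3 left|do 2 left; right|left; right|right].
Qed.

(** * The normal form of the elements of the infinite dihedral group *)

Section Dihedral.
Import GRing.Theory.
Local Open Scope ring_scope.
Context {G : groupType} {z s : G} (G_zs : infinite_dihedral z s).
Implicit Types (x y : dihedral_model) (i j k : int) (b d : bool) (N : set G).

(** This map turns out to be an isomorphism from the concrete model onto [G]; it reduces
    computations in [G] to arithmetic on pairs. *)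
Definition dihedral_elt x : G := (expgz z x.1 * (if x.2 then s else 1))%g.
Local Notation w := dihedral_elt.

Lemma dihedral_eltM x y : w (x * y)%g = (w x * w y)%g.
Proof.
have [rel _ _] := G_zs; have ss : (s * s = 1)%g by rewrite -expg2 rel.1.
case: x y => [i []] [j d]; rewrite dihedral_mulE /w /= expgzD; last first.
  by rewrite mulg1 mulgA.
rewrite -!mulgA; congr (_ * _)%g; rewrite mulgA (dihedral_expgzJ _ rel) -mulgA.
by congr (_ * _)%g; case: d => /=; rewrite ?mulg1 ?ss.
Qed.

(** The universal property, applied to the model, yields a morphism [f] back from [G] with
    [f (w x) = x]. This is what rules out proper quotients such as the finite dihedral groups. *)
Lemma dihedral_elt_inj : injective w.
Proof.
have [_ _ /(_ _ model_z model_s)] := G_zs.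
case=> [|f [fz fs]]; first by case: model_infinite_dihedral.
have f1 : f 1%g = 1%g by apply: (mulgI (f 1%g)); rewrite -gmulfM !mulg1.
have fX i : f (expgz z i) = expgz model_z i.
  elim: i => [|n IHn|n IHn]; first exact: f1.
    by rewrite -addn1 PoszD !expgzS gmulfM IHn fz.
  rewrite -addn1 PoszD opprD; apply: (mulIg model_z).
  by rewrite -expgzS -[in LHS]fz -gmulfM -expgzS !subrK.
have fw x : f (w x) = x.
  case: x => i b; rewrite /w gmulfM fX model_expgz /=.
  by case: b; rewrite ?fs ?f1 dihedral_mulE /= addr0.
exact: can_inj fw.
Qed.

Lemma dihedral_elt1 : w (0, false) = 1%g.
Proof. by rewrite /w mulg1. Qed.

Lemma dihedral_eltV x : w x^-1%g = (w x)^-1%g.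
Proof. by apply/esym/mulg1_eq; rewrite -dihedral_eltM mulgV dihedral_elt1. Qed.

(** The image of [w] is a subgroup containing the generators [z] and [s]. *)
Lemma dihedral_elt_surj (g : G) : exists x, g = w x.
Proof.
have [_ gen _] := G_zs; have : generated [set z; s] g by rewrite gen.
move=> /(_ [set h | exists x, h = w x]); apply; split=> /=.
  split=> [|g1 g2]; first by apply/mem_set; exists (0, false); rewrite dihedral_elt1.
  rewrite !unfold_in => /set_mem[x ->] /set_mem[y ->]; apply/mem_set.
  by exists (x * y^-1)%g; rewrite dihedral_eltM dihedral_eltV.
move=> _ [] ->; first by exists (1, false); rewrite /w mulg1.
by exists (0, true); rewrite /w mul1g.
Qed.

Lemma expgz_dihedral_elt i j : expgz (w (i, false)) j = w (i * j, false).
Proof.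
elim: j => [|n IHn|n IHn]; first by rewrite mulr0 dihedral_elt1.
- by rewrite -addn1 PoszD expgzS IHn mulrDr mulr1 -dihedral_eltM.
- by rewrite -addn1 PoszD opprD expgzP IHn mulrBr mulr1 -dihedral_eltV -dihedral_eltM.
Qed.

(* The product of a reflection with its conjugate by [z] is [z ^ 2]. *)
Lemma normal_dihedral_rotation N (x : G) : normal_subgroup N -> N x ->
  x != 1%g -> exists2 i, i != 0 & N (w (i, false)).
Proof.
move=> [sgN nN] Nx; have [[i [] xE]] := dihedral_elt_surj x; last first.
  move=> x1; exists i; rewrite -?xE//; apply: contra_neq x1 => i0.
  by rewrite xE i0 dihedral_elt1.
move=> _; exists 2 => //.
have := subgroupM sgN Nx (nN x (w (1, false)) Nx).
rewrite xE conjgE -dihedral_eltV -!dihedral_eltM !dihedral_mulE /=.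
by rewrite (_ : _ - _ = 2 :> int)//; lia.
Qed.

(** * The basic sets as blocks of a partition *)

(** One formula covers both families of basic sets: the exponent of [z] is fixed up to sign, and
    that of [s] is fixed only when the exponent of [z] is even. *)
Definition dihedral_block x : set G :=
  [set w y | y in [set y | `|y.1|%N = `|x.1|%N /\ ((2 %| x.1)%Z -> y.2 = x.2)]].
Local Notation block := dihedral_block.
Local Notation D := (dihedral_partition z s).

Lemma dihedral_blockE x g : block x g <-> exists2 y, g = w y &
  `|y.1|%N = `|x.1|%N /\ ((2 %| x.1)%Z -> y.2 = x.2).
Proof. by split=> -[y ? ?]; exists y. Qed.

Lemma dihedral_block_odd i b : ~~ (2 %| i)%Z ->
  block (i, b) = [set` [:: w (i, false); w (- i, false); w (i, true); w (- i, true)]].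
Proof.
move=> i_odd; apply/seteqP; split=> g.
  move=> [[j d] /= [ji _] <-]; rewrite !inE.
  have [->|->] : j = i \/ j = - i by lia.
    by case: d; rewrite eqxx ?orbT.
  by case: d; rewrite eqxx ?orbT.
rewrite /= !inE => /or4P[] /eqP ->; apply/dihedral_blockE; eexists; try reflexivity;
  by rewrite /= ?abszN (negPf i_odd).
Qed.

Lemma dihedral_block_even i b : (2 %| i)%Z ->
  block (i, b) = [set` [:: w (i, b); w (- i, b)]].
Proof.
move=> i_even; apply/seteqP; split=> g.
  move=> [[j d] /= [ji /(_ i_even) ->] <-]; rewrite !inE.
  have [->|->] : j = i \/ j = - i by lia.
    by rewrite eqxx.
  by rewrite eqxx orbT.
rewrite /= !inE => /orP[] /eqP ->; apply/dihedral_blockE; eexists; try reflexivity;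
  by rewrite /= ?abszN.
Qed.

Lemma dihedral_partitionE : D = range block.
Proof.
have wf i : w (i, false) = expgz z i by rewrite /w mulg1.
have wt i : w (i, true) = (expgz z i * s)%g by [].
apply/seteqP; split=> C.
  case=> [[i /= i_odd <-]|[i /= i_even [[|[|//]] _ <-]]].
  - by exists (i, false) => //; rewrite dihedral_block_odd// set_seq4 !wf.
  - by exists (i, false) => //; rewrite dihedral_block_even// set_seq2 !wf !mulg1.
  - by exists (i, true) => //; rewrite dihedral_block_even// set_seq2 !wt.
move=> [[i b] _ <-]; have [i_even|i_odd] := boolP (2 %| i)%Z.
  right; exists i => //; exists (nat_of_bool b); first by case: b.
  by rewrite dihedral_block_even// set_seq2; case: b; rewrite ?wf ?mulg1.
by left; exists i => //; rewrite dihedral_block_odd// set_seq4 !wf.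
Qed.

Lemma finite_dihedral_block x : finite_set (block x).
Proof.
case: x => i b; have [i_even|i_odd] := boolP (2 %| i)%Z.
  by rewrite dihedral_block_even.
by rewrite dihedral_block_odd.
Qed.

Lemma dihedral_block_refl x : block x (w x).
Proof. by exists x. Qed.

(** Any element determines its block: the absolute value of the exponent of [z] also fixes its
    parity, and in the even case the exponent of [s] can be read off as well. *)
Lemma dihedral_block_eq x y g : block x g -> block y g -> block x = block y.
Proof.
move=> [u [ux1 ux2] <-] [v [vy1 vy2] /dihedral_elt_inj vu].
rewrite {v}vu in vy1 vy2; have xy1 : `|x.1|%N = `|y.1|%N by rewrite -ux1.
have xy_even : (2 %| x.1)%Z = (2 %| y.1)%Z by rewrite !dvdzE xy1.
rewrite /block xy1 xy_even; congr (_ @` _); apply/seteqP; split=> t /= [-> tE];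
  by split=> // y_even; rewrite tE// -?ux2 ?vy2 ?xy_even.
Qed.

Lemma dihedral_partition_partition : partition D id setT.
Proof.
rewrite dihedral_partitionE; split.
- apply/seteqP; split=> // g _; have [x ->] := dihedral_elt_surj g.
  by exists (block x); [exists x|exact: dihedral_block_refl].
- by move=> _ _ [x _ <-] [y _ <-] [g [xg yg]]; exact: dihedral_block_eq xg yg.
- by move=> _ [x _ <-]; exists (w x); exact: dihedral_block_refl.
Qed.

(** Inversion fixes reflections and negates the exponent of rotations. One inclusion suffices, since
    inversion is an involution. *)
Lemma dihedral_block_invg x : set_invg (block x) = block x.
Proof.
have sub : set_invg (block x) `<=` block x.
  move=> _ [_ [y [yx1 yx2] <-] <-]; exists ((y : dihedral_model)^-1)%g.
    by case: y yx1 yx2 => i [] /=; rewrite ?abszN.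
  by rewrite dihedral_eltV.
apply/seteqP; split=> // g xg; exists g^-1%g; last by rewrite invgK.
by apply: sub; exists g.
Qed.


(** * Closure of the span under products *)

Section SchurRing.
Context {F : fieldType} (charF0 : [pchar F] =i pred0).
Local Notation A := (schur_span F D).

(* This is [(z ^ i + z ^ - i) s ^ b]; for [i = 0] it is twice the sum of the basic
   set [{s ^ b}], which is where characteristic [0] is used. *)
Definition dihedral_cosum i b : {malg F[G]} :=
  << w (i, b) >> + << w (- i, b) >>.
Local Notation c := dihedral_cosum.

(** The set sum of the block up to a nonzero scalar, in a form that needs no exception at
    [i = 0]. *)
Definition dihedral_block_sum x : {malg F[G]} :=
  if (2 %| x.1)%Z then c x.1 x.2 else c x.1 false + c x.1 true.

(** This is the product formula for cosines. A factor [s] on the left inverts the rotations after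
    it, which only permutes the four terms. *)
Lemma dihedral_cosumM i j b d :
  galg_mul (c i b) (c j d) = c (i + j) (b (+) d) + c (i - j) (b (+) d).
Proof.
rewrite galg_mulDl !galg_mulDr !galg_mulUU -!dihedral_eltM !dihedral_mulE /c /=.
rewrite !(opprK, opprD); case: b => /=.
  by rewrite [X in X + _ = _]addrC addrACA.
by rewrite [X in _ + X = _]addrC addrACA.
Qed.

Lemma set_sum_dihedral_block x :
  exists2 k : F, k != 0 & set_sum F (block x) = k *: dihedral_block_sum x.
Proof.
have w_inj := inj_eq dihedral_elt_inj.
case: x => i b; rewrite /dihedral_block_sum /=.
have [i_even|i_odd] := boolP (2 %| i)%Z; last first.
  exists 1; rewrite ?oner_eq0// scale1r dihedral_block_odd// set_sum_seq.
    by rewrite !big_cons big_nil addr0 /c -!addrA.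
  by rewrite /= !inE !w_inj -!pair_eqE /pair_eq /=; lia.
have [i0|i0] := eqVneq i 0; last first.
  exists 1; rewrite ?oner_eq0// scale1r dihedral_block_even// set_sum_seq.
    by rewrite !big_cons big_nil addr0.
  by rewrite /= !inE !w_inj -!pair_eqE /pair_eq /=; lia.
have F2 : 2 != 0 :> F by have /pcharf0P -> := charF0.
(* For [i = 0] the two listed elements coincide: the block is a singleton that [c 0 b] counts
   twice. *)
exists 2^-1; rewrite ?invr_eq0// dihedral_block_even// i0 oppr0 /c oppr0.
have -> : [set` [:: w (0, b); w (0, b)]] = [set` [:: w (0, b)]].
  by apply/seteqP; split=> g /=; rewrite !inE orbb.
by rewrite set_sum_seq// big_seq1 -mulr2n -scaler_nat scalerK.
Qed.

Lemma schur_span_dihedral_block_sum x : A (dihedral_block_sum x).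
Proof.
have [k k0 xE] := set_sum_dihedral_block x.
rewrite -(scalerK k0 (dihedral_block_sum x)) -xE; apply: schur_spanZ.
by apply: schur_span_set_sum; rewrite dihedral_partitionE; exists x.
Qed.

Lemma schur_span_dihedral_cosum i b : (2 %| i)%Z -> A (c i b).
Proof.
move=> i_even; have := schur_span_dihedral_block_sum (i, b).
by rewrite /dihedral_block_sum i_even.
Qed.

Lemma schur_span_dihedral_cosum2 i b : A (c i b + c i (~~ b)).
Proof.
have [i_even|i_odd] := boolP (2 %| i)%Z.
  by apply: schur_spanD; apply: schur_span_dihedral_cosum.
have := schur_span_dihedral_block_sum (i, b).
by rewrite /dihedral_block_sum (negPf i_odd); case: b; rewrite //= addrC.
Qed.

(** If both indices have the same parity, [i + j] and [i - j] are even and each resulting term lies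
    in the span by itself. If the parities differ, the terms are regrouped so that both exponents of
    [s] occur together for each index. *)
Lemma galg_mul_dihedral_block_sum x y :
  A (galg_mul (dihedral_block_sum x) (dihedral_block_sum y)).
Proof.
case: x y => [i b] [j d]; rewrite /dihedral_block_sum /=.
have [i_even|i_odd] := boolP (2 %| i)%Z; have [j_even|j_odd] := boolP (2 %| j)%Z.
- rewrite dihedral_cosumM.
  by apply: schur_spanD; apply: schur_span_dihedral_cosum; lia.
- rewrite galg_mulDr !dihedral_cosumM addbT addbF addrACA.
  by apply: schur_spanD; apply: schur_span_dihedral_cosum2.
- rewrite galg_mulDl !dihedral_cosumM addrACA /=.
  by apply: schur_spanD; apply: schur_span_dihedral_cosum2.
rewrite galg_mulDl (galg_mulDr (c i false)) (galg_mulDr (c i true)) !dihedral_cosumM.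
by do 3!apply: schur_spanD; apply: schur_span_dihedral_cosum; lia.
Qed.

Lemma dihedral_schur_ring : schur_ring setT D A.
Proof.
have DE := dihedral_partitionE; split=> //.
- split; first exact: mem_set.
  by move=> g h _ _; exact: mem_set.
- split; first exact: dihedral_partition_partition.
  by rewrite DE => _ [x _ <-]; exact: finite_dihedral_block.
split; first last.
- rewrite DE => _ _ [x _ <-] [y _ <-]; rewrite -DE.
  have [k _ ->] := set_sum_dihedral_block x.
  have [l _ ->] := set_sum_dihedral_block y.
  rewrite galg_mulZ; apply: schur_spanZ; exact: galg_mul_dihedral_block_sum.
- by rewrite DE => _ [x _ <-]; exists x; rewrite // dihedral_block_invg.
(* The basic set of the identity is the degenerate block at index 0, where both listed elements are
   1. *)
rewrite DE; exists (0, false) => //; rewrite dihedral_block_even//.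
by rewrite set_seq2 oppr0 setUid dihedral_elt1.
Qed.

End SchurRing.

(** * The rotation subgroup and the four traditional types *)

(** A union of basic sets containing [z] contains the whole block of [z], hence the reflection
    [z * s]. *)
Lemma dihedral_rotation_not_schur_subgroup : ~ schur_subgroup D (generated [set z]).
Proof.
move=> [_ [B BD zB]]; have gz : (generated [set z]) z by move=> N [_]; apply.
have : (\bigcup_(C in B) C) z by rewrite -zB.
move=> [C BC Cz]; have : D C by exact: BD.
rewrite dihedral_partitionE => -[x _ xC].
have wz : w (1, false) = z by rewrite /w mulg1.
have xE : block x = block (1, false).
  apply: (@dihedral_block_eq _ _ z); first by rewrite xC.
  by rewrite -wz; exact: dihedral_block_refl.
have : (generated [set z]) (w (1, true)).
  by rewrite zB; exists C => //; rewrite -xC xE; exists (1, true).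
(* The rotations form a subgroup containing [z], hence contain the subgroup generated by [z], but
   not [z * s]. *)
move=> /(_ (range (fun i => w (i, false)))); case.
  split=> [|_ ->]; last by exists 1.
  split; first by apply/mem_set; exists 0; rewrite ?dihedral_elt1.
  move=> g h; rewrite !unfold_in => /set_mem[i _ <-] /set_mem[j _ <-].
  by apply/mem_set; exists (i - j); rewrite // -dihedral_eltV -dihedral_eltM.
by move=> i _ /dihedral_elt_inj.
Qed.

(** Multiplication by a nonzero [i] is injective on integers. Thus any subgroup with a nontrivial
    rotation is infinite. *)
Lemma infinite_dihedral_rotations i : i != 0 ->
  ~ finite_set (range (fun j => w (i * j, false))).
Proof.
move=> i0 fin; apply: infinite_nat.
have inj : injective (fun n : nat => w (i * n%:Z, false)).
  by move=> m n /dihedral_elt_inj [] /(mulfI i0) [].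
apply: (sub_finite_set _ (finite_preimage (in2W inj) fin)).
by move=> n _; exists n%:Z.
Qed.

Lemma dihedral_not_trivial_schur_ring : ~ trivial_schur_ring D.
Proof.
move=> [fin _]; apply: (@infinite_dihedral_rotations 1) => //.
exact: sub_finite_set fin.
Qed.

Lemma dihedral_not_tensor_schur_ring (F : fieldType) : ~ tensor_schur_ring F D.
Proof.
move=> [H [K [[sgH HT] [sgK KT] HK _]]].
have KH := internal_direct_product_sym sgH sgK HK.
have nH := internal_direct_product_normal sgH HK.
have nK := internal_direct_product_normal sgK KH.
have [x Hx x1] := internal_direct_product_neq1 sgK KT HK.
have [y Ky y1] := internal_direct_product_neq1 sgH HT KH.
have [i i0 Hi] := normal_dihedral_rotation nH Hx x1.
have [j j0 Kj] := normal_dihedral_rotation nK Ky y1.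
(* The rotation by [i * j] is a power of both rotations found, so it lies in both factors, and it is
   nontrivial. *)
have [_ HK1 _] := HK; have : (H `&` K) (w (i * j, false)).
  split; first by rewrite -expgz_dihedral_elt; apply: subgroup_expgz.
  by rewrite mulrC -expgz_dihedral_elt; apply: subgroup_expgz.
rewrite HK1 /= -dihedral_elt1 => /dihedral_elt_inj[] /eqP.
by rewrite mulf_eq0 (negPf i0) (negPf j0).
Qed.

(** The block of an element outside [H] is a union of cosets of [K]. Blocks are finite, so [K] is
    finite, whereas a nontrivial normal subgroup contains infinitely many rotations. *)
Lemma dihedral_not_wedge_schur_ring : ~ wedge_schur_ring D.
Proof.
move=> [H [K [[_ _ HT] [[sgK _] K1 _] _ nK]]] HK.
have [g Hg] : exists g, ~ H g.
  by apply: contrapT => HT'; case/eqP: HT; apply/seteqP; split=> // g _;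
    apply: contrapT => Hg; apply: HT'; exists g.
have [x gE] := dihedral_elt_surj g.
have xg : block x g by rewrite gE; exact: dihedral_block_refl.
have [|xH|X xX] := HK (block x).
- by rewrite dihedral_partitionE; exists x.
- by apply: Hg; exact: xH.
have : (\bigcup_(t in X) set_mulg [set t] K) g by rewrite -xX.
move=> [t Xt _].
have K_fin : finite_set K.
  (* Left translation by [t] embeds [K] into the block. *)
  apply: (@sub_finite_set G K ((fun k : G => t * k)%g @^-1` block x)).
    by move=> k Kk; rewrite /= xX; exists t => //; exists t => //; exists k.
  by apply: finite_preimage (finite_dihedral_block x); apply: in2W; exact: mulgI.
have [y Ky y1] : exists2 y, K y & y != 1%g.
  apply: contrapT => K1'; case/eqP: K1; apply/seteqP; split=> y /=.
    by move=> Ky; apply: contrapT => /eqP y1; apply: K1'; exists y.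
  by move=> ->; exact: subgroup1.
have [i i0 Ki] := normal_dihedral_rotation nK Ky y1.
apply: (infinite_dihedral_rotations i0); apply: sub_finite_set K_fin => _ [j _ <-].
by rewrite -expgz_dihedral_elt; apply: subgroup_expgz.
Qed.

(* An automorphism fixing the sum of the block of [z] maps [z] to [z] or [z^-1], as
   [z] has infinite order; so [z + z^-1] is fixed, but it is not constant on the
   block. *)
Lemma dihedral_not_orbit_schur_ring (F : fieldType) :
  ~ orbit_schur_ring (schur_span F D).
Proof.
move=> [K [_ KM _ _ KV] AE].
have fin C : D C -> finite_set C.
  by rewrite dihedral_partitionE => -[x _ <-]; exact: finite_dihedral_block.
have [_ D_triv _] := dihedral_partition_partition.
have Dz : D (block (1, false)) by rewrite dihedral_partitionE; exists (1, false).
pose S := [set w (1, false); w (-1, false)].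
have S_fin : finite_set S by rewrite /S -set_seq2.
have SK (k : G -> G) g : K k -> (k g \in S) = (g \in S).
  move=> Kk; have kM := KM k Kk.
  have k_inj : injective k by have [l [_ /can_inj]] := KV k Kk.
  have k1 : k 1%g = 1%g by apply: (mulgI (k 1%g)); rewrite -kM !mulg1.
  have wV : w (-1, false) = (w (1%R, false))^-1%g by rewrite -dihedral_eltV.
  have kV : k (w (-1, false)) = (k (w (1%R, false)))^-1%g.
    by apply/esym/mulg1_eq; rewrite -kM wV mulgV.
  (* The block sum of [z] is fixed by [k], so its coefficient at the image of [z] equals that at
     [z], namely 1. *)
  have kz : k (w (1, false)) \in block (1, false).
    have : (galg_fixed F K) (set_sum F (block (1, false))).
      by rewrite -AE; apply: schur_span_set_sum.
    move=> /(_ k Kk) /(congr1 (mcoeff (k (w (1, false))))).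
    have block_fin := finite_dihedral_block (1, false).
    rewrite mcoeff_galg_act// !mcoeff_set_sum//.
    rewrite (mem_set (dihedral_block_refl _)).
    by case: (k _ \in _) => // /eqP; rewrite oner_eq0.
  (* Reflections square to 1, while [z] does not. *)
  have kz_rotation i : k (w (1, false)) <> w (i, true).
    move=> kzi; have : (w (1%R, false) * w (1%R, false))%g = 1%g.
      apply: k_inj; rewrite kM kzi k1 -dihedral_eltM dihedral_mulE /= subrr.
      exact: dihedral_elt1.
    by rewrite -dihedral_eltM -dihedral_elt1 => /dihedral_elt_inj.
  have SE h : (h \in S) = (h == w (1, false)) || (h == w (-1, false)).
    by rewrite /S -set_seq2 mem_setE !inE.
  have := set_mem kz; rewrite dihedral_block_odd// set_seq4 !SE.
  case=> [[[kzE|kzE]|/kz_rotation//]|/kz_rotation//].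
    have kVE : k (w (-1, false)) = w (-1, false) by rewrite kV kzE wV.
    by rewrite -{1}kzE -{1}kVE !inj_eq.
  have kVE : k (w (-1, false)) = w (1, false) by rewrite kV kzE wV invgK.
  by rewrite orbC -{1}kzE -{2}kVE !inj_eq.
have : (galg_fixed F K) (set_sum F S).
  move=> k Kk; have [l [_ kl lk]] := KV k Kk; have k_inj := can_inj kl.
  apply/malgP => g; rewrite -(lk g) mcoeff_galg_act//.
  by rewrite !mcoeff_set_sum// (SK k).
rewrite -AE => S_A.
(* The sum of [S] would lie in the span, yet it has coefficient 1 at [z] and 0 at [z * s], two
   elements of one block. *)
have zs_block : block (1, false) (w (1, true)) by exists (1, true).
have := mcoeff_schur_span D_triv fin S_A Dz (dihedral_block_refl _) zs_block.
rewrite !mcoeff_set_sum// mem_set; last by left.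
rewrite memNset => [/eqP|]; first by rewrite oner_eq0.
by case=> /dihedral_elt_inj.
Qed.

End Dihedral.

Theorem theorem1p2 (F : fieldType) (charF0 : [pchar F]%R =i pred0)
    (Dinf : groupType) (z s : Dinf) (Dinf_zs : infinite_dihedral z s) :
  let D := dihedral_partition z s in
  let A := schur_span F D in
  [/\ schur_ring [set: Dinf] D A,
      ~ schur_subgroup D (generated [set z]) &
      ~ traditional D A].
Proof.
split; first exact: dihedral_schur_ring.
  exact: dihedral_rotation_not_schur_subgroup.
case.
- exact: dihedral_not_trivial_schur_ring.
- exact: dihedral_not_orbit_schur_ring.
- exact: dihedral_not_tensor_schur_ring.
- exact: dihedral_not_wedge_schur_ring.
Qed.
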